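(* Let $\alpha \in \mathbb{D}$ and let $\varphi_\alpha(z) = \frac{z - \alpha}{1 - \overline{\alpha} z}$ for $z \in \mathbb{D}$. Then the Berezin range $B(C_{\varphi_\alpha})$ of the composition operator $C_{\varphi_\alpha}$ on $H^2$ is convex if and only if $\alpha = 0$.
   Context: $\mathbb{D}$ is the open unit disk in $\mathbb{C}$. $H^2$ is the Hardy space of holomorphic functions $f(z) = \sum_{n\ge 0} a_n z^n$ on $\mathbb{D}$ with $\sum_{n \ge 0} |a_n|^2 < \infty$, with inner product $\langle \sum a_n z^n, \sum b_n z^n\rangle = \sum_{n\ge 0} a_n \overline{b_n}$. Its reproducing kernel at $w \in \mathbb{D}$ (the element $k_w \in H^2$ with $\langle f, k_w \rangle = f(w)$ for all $f \in H^2$) is $k_w(z) = \frac{1}{1 - \overline{w} z}$, and $\hat{k}_w = k_w/\|k_w\|$ is the normalized reproducing kernel. For a bounded linear operator $T$ on $H^2$, the Berezin range is $B(T) = \{\langle T\hat{k}_z, \hat{k}_z\rangle : z \in \mathbb{D}\} \subseteq \mathbb{C}$. The composition operator with symbol $\varphi : \mathbb{D} \to \mathbb{D}$ is $C_\varphi f = f\circ\varphi$. *)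

(* Defs.v *)
From Stdlib Require Import Reals Lra Lia ClassicalEpsilon.
From Coquelicot Require Import Coquelicot.

Open Scope R_scope.

Definition disk : Type := { z : C | Cmod z < 1 }.
Definition disk_val (z : disk) : C := proj1_sig z.
Coercion disk_val : disk >-> C.

Definition taylor_on_disk (f : disk -> C) (a : nat -> C) : Prop :=
  forall z : disk,
    is_pseries (K := C_AbsRing) (V := C_NormedModule) a (z : C) (f z).

Definition square_summable (a : nat -> C) : Prop :=
  ex_series (fun n : nat => Cmod (a n) ^ 2).

(* A function which is the sum of a power series on the whole disk is the same
   thing as a holomorphic function on the disk, so holomorphy is not required
   separately. *)
Definition in_H2 (f : disk -> C) : Prop :=
  exists a : nat -> C, square_summable a /\ taylor_on_disk f a.

Record H2 : Type := mkH2 { H2_fun :> disk -> C; H2_in : in_H2 H2_fun }.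

(* The choice made here is immaterial: the Taylor coefficients of a function
   are unique. *)
Definition coeff (f : H2) : nat -> C :=
  proj1_sig (constructive_indefinite_description _ (H2_in f)).

Lemma coeff_square_summable (f : H2) : square_summable (coeff f).
Proof.
exact (proj1 (proj2_sig (constructive_indefinite_description _ (H2_in f)))).
Qed.

Lemma coeff_taylor (f : H2) : taylor_on_disk f (coeff f).
Proof.
exact (proj2 (proj2_sig (constructive_indefinite_description _ (H2_in f)))).
Qed.

(* Coquelicot's [Series] is for real series only. *)
Definition CSeries (a : nat -> C) : C :=
  (Series (fun n => Re (a n)), Series (fun n => Im (a n))).

Definition inner (f g : H2) : C :=
  CSeries (fun n : nat => (coeff f n * Cconj (coeff g n))%C).

Definition H2_norm (f : H2) : R := sqrt (Re (inner f f)).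

Lemma in_H2_scal (c : C) (f : H2) : in_H2 (fun z : disk => (c * f z)%C).
Proof.
exists (fun n => (c * coeff f n)%C); split.
- unfold square_summable.
  apply ex_series_ext with (fun n => scal (Cmod c ^ 2) (Cmod (coeff f n) ^ 2)).
  + intros n; rewrite Cmod_mult; unfold scal; simpl; unfold mult; simpl; ring.
  + apply (ex_series_scal (K := R_AbsRing) (V := R_NormedModule) (Cmod c ^ 2)).
    apply coeff_square_summable.
- intros z.
  generalize (is_series_scal (K := C_AbsRing) (V := C_NormedModule)
                c _ _ (coeff_taylor f z)).
  apply is_series_ext; intros n.
  change (c * (pow_n (K := C_Ring) (z : C) n * coeff f n)
          = pow_n (K := C_Ring) (z : C) n * (c * coeff f n))%C.
  ring.
Qed.

Definition H2_scal (c : C) (f : H2) : H2 := mkH2 _ (in_H2_scal c f).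

Lemma one_minus_neq0 (q : C) : Cmod q < 1 -> (1 - q)%C <> RtoC 0.
Proof.
intros Hq H.
assert (Hq1 : q = RtoC 1).
{ replace q with (1 - (1 - q))%C by ring. rewrite H; ring. }
rewrite Hq1, Cmod_1 in Hq; lra.
Qed.

Lemma pow_n_C (z : C) (n : nat) : pow_n (K := C_Ring) z n = (z ^ n)%C.
Proof.
induction n as [|n IH]; [reflexivity|].
change (z * pow_n (K := C_Ring) z n = z * z ^ n)%C; now rewrite IH.
Qed.

Lemma is_series_C_geom (q : C) : Cmod q < 1 ->
  is_series (K := C_AbsRing) (V := C_NormedModule)
    (fun n => (q ^ n)%C) (/ (1 - q))%C.
Proof.
intros Hq.
pose proof (one_minus_neq0 q Hq) as Hne.
assert (Hs : forall n, sum_n (G := C_NormedModule) (fun n => (q ^ n)%C) n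
                       = ((1 - q ^ S n) * / (1 - q))%C).
{ induction n as [|n IH].
  - rewrite sum_O; simpl; field; exact Hne.
  - rewrite sum_Sn, IH.
    change ((1 - q ^ S n) * / (1 - q) + q ^ S n
            = (1 - q ^ S (S n)) * / (1 - q))%C.
    rewrite (Cpow_S q (S n)); field; exact Hne. }
apply filterlim_locally; intros eps.
assert (Hd : 0 < Cmod (1 - q)) by now apply Cmod_gt_0.
assert (Hpos : 0 < eps * Cmod (1 - q))
  by (apply Rmult_lt_0_compat; [apply cond_pos | exact Hd]).
destruct (pow_lt_1_zero (Cmod q)) with (y := eps * Cmod (1 - q)) as [N HN].
{ rewrite Rabs_pos_eq; [exact Hq | apply Cmod_ge_0]. }
{ exact Hpos. }
exists N; intros n Hn.
apply C_NormedModule_mixin_compat1.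
rewrite Hs.
change (Cmod ((1 - q ^ S n) * / (1 - q) - / (1 - q))%C < eps).
replace ((1 - q ^ S n) * / (1 - q) - / (1 - q))%C
  with (- (q ^ S n / (1 - q)))%C by (field; exact Hne).
rewrite Cmod_opp, Cmod_div, Cmod_pow by exact Hne.
apply Rmult_lt_reg_r with (Cmod (1 - q)); [exact Hd|].
unfold Rdiv; rewrite Rmult_assoc, Rinv_l, Rmult_1_r by lra.
apply Rle_lt_trans with (Rabs (Cmod q ^ S n)); [apply Rle_abs|].
apply HN; lia.
Qed.

Lemma Cmod_conj_mult_lt1 (w z : disk) : Cmod (Cconj w * z) < 1.
Proof.
destruct w as [w Hw], z as [z Hz]; simpl.
rewrite Cmod_mult, Cmod_conj.
pose proof (Cmod_ge_0 w); pose proof (Cmod_ge_0 z); nra.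
Qed.

Lemma in_H2_kernel (w : disk) :
  in_H2 (fun z : disk => (1 / (1 - Cconj w * z))%C).
Proof.
exists (fun n => (Cconj w ^ n)%C); split.
- unfold square_summable.
  apply ex_series_ext with (fun n => (Cmod w ^ 2) ^ n).
  + intros n; rewrite Cmod_pow, Cmod_conj.
    rewrite <- !pow_mult; f_equal; lia.
  + apply ex_series_geom.
    destruct w as [w Hw]; simpl.
    pose proof (Cmod_ge_0 w); rewrite Rabs_pos_eq; nra.
- intros z; unfold is_pseries, Cdiv; rewrite Cmult_1_l.
  generalize (is_series_C_geom _ (Cmod_conj_mult_lt1 w z)).
  apply is_series_ext; intros n.
  change ((Cconj w * z) ^ n
          = pow_n (K := C_Ring) (z : C) n * Cconj w ^ n)%C.
  rewrite (pow_n_C z), Cpow_mult_l; ring.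
Qed.

Definition kernel (w : disk) : H2 := mkH2 _ (in_H2_kernel w).

Definition normalized_kernel (w : disk) : H2 :=
  H2_scal (RtoC (/ H2_norm (kernel w))) (kernel w).

Definition berezin_range (T : H2 -> H2) (u : C) : Prop :=
  exists z : disk, u = inner (T (normalized_kernel z)) (normalized_kernel z).

(* By Littlewood's subordination theorem [f o phi] is in H2 for every
   holomorphic [phi : disk -> disk], so the default value is never used for
   such a symbol. *)
Definition comp_op (phi : disk -> disk) (f : H2) : H2 :=
  match excluded_middle_informative (in_H2 (fun z => f (phi z))) with
  | left Hf => mkH2 (fun z => f (phi z)) Hf
  | right _ => f
  end.

Definition Cconvex (S : C -> Prop) : Prop :=
  forall (u v : C) (t : R), S u -> S v -> 0 <= t <= 1 ->
    S (RtoC t * u + RtoC (1 - t) * v)%C.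

Lemma moebius_in_disk (alpha z : disk) :
  Cmod ((z - alpha) / (1 - Cconj alpha * z)) < 1.
Proof.
pose proof (one_minus_neq0 _ (Cmod_conj_mult_lt1 alpha z)) as Hne.
rewrite Cmod_div by exact Hne.
assert (Hd : 0 < Cmod (1 - Cconj alpha * z)) by now apply Cmod_gt_0.
apply Rmult_lt_reg_r with (Cmod (1 - Cconj alpha * z)); [exact Hd|].
unfold Rdiv; rewrite Rmult_assoc, Rinv_l, Rmult_1_r, Rmult_1_l by lra.
apply Rsqr_incrst_0; [|apply Cmod_ge_0|lra].
rewrite !Rsqr_pow2, !Cmod2_alt.
clear Hne Hd.
destruct alpha as [[a b] Ha], z as [[x y] Hz]; simpl in *.
assert (Ha2 : a ^ 2 + b ^ 2 < 1).
{ change (Re (a, b) ^ 2 + Im (a, b) ^ 2 < 1); rewrite <- Cmod2_alt.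
  pose proof (Cmod_ge_0 (a, b)); nra. }
assert (Hz2 : x ^ 2 + y ^ 2 < 1).
{ change (Re (x, y) ^ 2 + Im (x, y) ^ 2 < 1); rewrite <- Cmod2_alt.
  pose proof (Cmod_ge_0 (x, y)); nra. }
assert (H : 0 < (1 - (a ^ 2 + b ^ 2)) * (1 - (x ^ 2 + y ^ 2)))
  by (apply Rmult_lt_0_compat; lra).
nra.
Qed.

Definition moebius (alpha z : disk) : disk :=
  exist _ ((z - alpha) / (1 - Cconj alpha * z))%C (moebius_in_disk alpha z).

(* Main.v *)
Require Import Defs.
From Stdlib Require Import Reals Lra ClassicalEpsilon.
From Coquelicot Require Import Coquelicot.

(** Write [F z] for the value at [z] of the Berezin transform of the composition
    operator with symbol [phi = moebius alpha].  The reproducing property turns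
    it into [(1 - |z|^2) / (1 - conj z * phi z)], that is
    [s (1 - zeta) / (s - 2 i Im zeta)] with [s = 1 - |z|^2] and
    [zeta = conj alpha * z] ([berezin_moebius]).

    For [alpha = 0] this is constantly 1, and a singleton is convex.

    For [alpha <> 0] convexity is refuted on the real axis.  The imaginary part
    of [F z] is a positive multiple of [Im zeta], so [F] is real only where
    [zeta] is, and there [F z = 1 - Re zeta >= 1 - |alpha|]
    ([berezin_moebius_real]).  On the other hand the points [i alpha t] and
    [- i alpha t] have conjugate values, whose midpoint is real and tends to 0
    as the two points approach the unit circle; close enough to the circle the
    midpoint is below [1 - |alpha|], hence it lies outside the range
    ([berezin_moebius_conj], [midpoint_small]).

    The transform itself is read off from Taylor coefficients.  They are unique
    ([taylor_unique]), so those of the kernel are the powers of [conj w] and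
    the inner product with the kernel sums the Taylor series ([inner_kernel]).
    The composite of a kernel with a Moebius map is a quotient of affine
    functions without pole in the closed disk, hence it lies in H2
    ([in_H2_kernel_moebius]). *)

(** * Complex series and uniqueness of Taylor coefficients *)

Lemma is_series_Re_Im (u : nat -> C) (l : C) :
  is_series (K := C_AbsRing) (V := C_NormedModule) u l ->
  is_series (fun n => Re (u n)) (Re l) /\ is_series (fun n => Im (u n)) (Im l).
Proof.
intros H.
assert (Hr : forall n, sum_n (fun k => Re (u k)) n
                       = Re (sum_n (G := C_NormedModule) u n)).
{ induction n as [|n IH]; [now rewrite !sum_O|].
  now rewrite !sum_Sn, IH. }
assert (Hi : forall n, sum_n (fun k => Im (u k)) n
                       = Im (sum_n (G := C_NormedModule) u n)).
{ induction n as [|n IH]; [now rewrite !sum_O|].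
  now rewrite !sum_Sn, IH. }
split; apply filterlim_locally; intros eps;
  destruct (proj1 (filterlim_locally _ _) H eps) as [N HN];
  exists N; intros n Hn; destruct (HN n Hn) as [H1 H2].
- rewrite Hr; exact H1.
- rewrite Hi; exact H2.
Qed.

Lemma Cconj_RtoC (r : R) : Cconj (RtoC r) = RtoC r.
Proof. apply injective_projections; simpl; ring. Qed.

Lemma CSeries_unique (u : nat -> C) (l : C) :
  is_series (K := C_AbsRing) (V := C_NormedModule) u l -> CSeries u = l.
Proof.
intros H; destruct (is_series_Re_Im _ _ H) as [Hr Hi].
unfold CSeries; rewrite (is_series_unique _ _ Hr), (is_series_unique _ _ Hi).
now destruct l.
Qed.

Lemma CSeries_ext (u v : nat -> C) :
  (forall n, u n = v n) -> CSeries u = CSeries v.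
Proof.
intros H; unfold CSeries; f_equal; apply Series_ext; intros n; now rewrite H.
Qed.

Lemma CSeries_scal (r : R) (u : nat -> C) :
  CSeries (fun n => RtoC r * u n)%C = (RtoC r * CSeries u)%C.
Proof.
apply injective_projections.
- change (Series (fun n => Re (RtoC r * u n)) = Re (RtoC r * CSeries u)).
  rewrite re_scal_l; simpl; rewrite <- Series_scal_l.
  apply Series_ext; intros n; apply re_scal_l.
- change (Series (fun n => Im (RtoC r * u n)) = Im (RtoC r * CSeries u)).
  rewrite im_scal_l; simpl; rewrite <- Series_scal_l.
  apply Series_ext; intros n; apply im_scal_l.
Qed.

Lemma CV_radius_pos_of_half (a : nat -> R) (l : R) :
  is_series (fun n => a n * (1 / 2) ^ n) l -> Rbar_lt 0 (CV_radius a).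
Proof.
intros H.
apply Rbar_lt_le_trans with (Finite (1 / 2)); [simpl; lra|].
destruct (CV_radius_bounded a) as [Hub _]; apply Hub.
assert (Hl : is_lim_seq (fun n => a n * (1 / 2) ^ n) 0)
  by (apply ex_series_lim_0; now exists l).
destruct (filterlim_bounded (K := R_AbsRing) (V := R_NormedModule)
            (fun n => a n * (1 / 2) ^ n)) as [M HM].
{ now exists 0. }
now exists M.
Qed.

Lemma real_in_disk (x : R) : Rabs x < 1 -> Cmod (RtoC x) < 1.
Proof. now rewrite Cmod_R. Qed.

(** Restricted to the real diameter, the real and imaginary parts of a Taylor
    series are real power series, for which uniqueness is known. *)
Lemma taylor_unique (f : disk -> C) (a b : nat -> C) :
  taylor_on_disk f a -> taylor_on_disk f b -> forall n, a n = b n.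
Proof.
intros Ha Hb.
assert (Hsplit : forall c, taylor_on_disk f c -> forall x (Hx : Rabs x < 1),
  is_series (fun n => Re (c n) * x ^ n)
            (Re (f (exist _ (RtoC x) (real_in_disk x Hx)))) /\
  is_series (fun n => Im (c n) * x ^ n)
            (Im (f (exist _ (RtoC x) (real_in_disk x Hx))))).
{ intros c Hc x Hx.
  destruct (is_series_Re_Im _ _ (Hc (exist _ (RtoC x) (real_in_disk x Hx))))
    as [Hr Hi].
  assert (Hterm : forall n, scal (pow_n (K := C_Ring) (RtoC x) n) (c n)
                            = (RtoC (x ^ n) * c n)%C).
  { intros n.
    change (pow_n (K := C_Ring) (RtoC x) n * c n = RtoC (x ^ n) * c n)%C.
    now rewrite (pow_n_C (RtoC x)), RtoC_pow. }
  split.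
  - revert Hr; apply is_series_ext; intros n; simpl disk_val.
    rewrite Hterm, re_scal_l; apply Rmult_comm.
  - revert Hi; apply is_series_ext; intros n; simpl disk_val.
    rewrite Hterm, im_scal_l; apply Rmult_comm. }
assert (Hhalf : Rabs (1 / 2) < 1) by (rewrite Rabs_pos_eq; lra).
assert (Hext : forall u v : nat -> R,
  (forall x (Hx : Rabs x < 1), exists l,
     is_series (fun n => u n * x ^ n) l /\ is_series (fun n => v n * x ^ n) l) ->
  forall n, u n = v n).
{ intros u v H n.
  destruct (H _ Hhalf) as [l [Hu Hv]].
  apply PSeries_ext_recip.
  - exact (CV_radius_pos_of_half _ _ Hu).
  - exact (CV_radius_pos_of_half _ _ Hv).
  - exists (mkposreal 1 Rlt_0_1); intros x Hx.
    assert (Hx1 : Rabs x < 1).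
    { change (Rabs (x - 0) < 1) in Hx; now rewrite Rminus_0_r in Hx. }
    destruct (H x Hx1) as [m [H1 H2]]; unfold PSeries.
    now rewrite (is_series_unique _ _ H1), (is_series_unique _ _ H2). }
intros n; apply injective_projections.
- apply (Hext (fun n => Re (a n)) (fun n => Re (b n))); intros x Hx.
  exact (ex_intro _ _ (conj (proj1 (Hsplit a Ha x Hx))
                            (proj1 (Hsplit b Hb x Hx)))).
- apply (Hext (fun n => Im (a n)) (fun n => Im (b n))); intros x Hx.
  exact (ex_intro _ _ (conj (proj2 (Hsplit a Ha x Hx))
                            (proj2 (Hsplit b Hb x Hx)))).
Qed.

(** * Quotients of affine functions in H2 *)

Definition affine_quotient_coeff (p q c : C) (n : nat) : C :=
  match n with
  | O => p
  | S m => ((q + p * c) * c ^ m)%C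
  end.

Lemma Cmod_mult_lt1 (c : C) (z : disk) : Cmod c < 1 -> Cmod (c * z) < 1.
Proof.
intros Hc; destruct z as [z Hz]; simpl; rewrite Cmod_mult.
pose proof (Cmod_ge_0 c); pose proof (Cmod_ge_0 z); nra.
Qed.

(** Once the constant term [p] is removed,
    [(p + q z) / (1 - c z) - p = (q + p c) z / (1 - c z)] is a geometric
    series. *)
Lemma taylor_affine_quotient (p q c : C) : Cmod c < 1 ->
  taylor_on_disk (fun z => ((p + q * z) / (1 - c * z))%C)
    (affine_quotient_coeff p q c).
Proof.
intros Hc z; apply is_series_decr_1.
pose proof (Cmod_mult_lt1 c z Hc) as Hcz.
pose proof (one_minus_neq0 _ Hcz) as Hne.
generalize (is_series_scal (K := C_AbsRing) (V := C_NormedModule)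
              (z * (q + p * c))%C _ _ (is_series_C_geom _ Hcz)).
match goal with |- is_series _ ?l -> is_series _ ?m =>
  replace m with l end.
- apply is_series_ext; intros n.
  change (z * (q + p * c) * (c * z) ^ n
    = pow_n (K := C_Ring) (z : C) (S n) * ((q + p * c) * c ^ n))%C.
  rewrite (pow_n_C z), Cpow_mult_l, Cpow_S; ring.
- change (z * (q + p * c) * / (1 - c * z)
          = (p + q * z) / (1 - c * z) + - (1 * p))%C.
  field; exact Hne.
Qed.

Lemma square_summable_affine_quotient (p q c : C) : Cmod c < 1 ->
  square_summable (affine_quotient_coeff p q c).
Proof.
intros Hc; unfold square_summable; apply ex_series_incr_1.
apply ex_series_ext with
  (fun n => scal (Cmod (q + p * c) ^ 2) ((Cmod c ^ 2) ^ n)).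
- intros n; unfold affine_quotient_coeff; rewrite Cmod_mult, Cmod_pow.
  rewrite Rpow_mult_distr, <- !pow_mult, (Nat.mul_comm n); reflexivity.
- apply (ex_series_scal (K := R_AbsRing) (V := R_NormedModule)).
  apply ex_series_geom.
  pose proof (Cmod_ge_0 c); rewrite Rabs_pos_eq; nra.
Qed.

Lemma in_H2_ext (f g : disk -> C) :
  (forall z, f z = g z) -> in_H2 f -> in_H2 g.
Proof.
intros Hfg [a [Hs Ht]]; exists a; split; [exact Hs|].
intros z; rewrite <- Hfg; apply Ht.
Qed.

Lemma in_H2_affine_quotient (p q c : C) : Cmod c < 1 ->
  in_H2 (fun z => ((p + q * z) / (1 - c * z))%C).
Proof.
intros Hc; exists (affine_quotient_coeff p q c); split.
- now apply square_summable_affine_quotient.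
- now apply taylor_affine_quotient.
Qed.

(** * The reproducing property *)

Lemma coeff_scal (c : C) (f : H2) (n : nat) :
  coeff (H2_scal c f) n = (c * coeff f n)%C.
Proof.
revert n; apply (taylor_unique (H2_scal c f)); [apply coeff_taylor|].
intros z.
generalize (is_series_scal (K := C_AbsRing) (V := C_NormedModule)
              c _ _ (coeff_taylor f z)).
apply is_series_ext; intros n.
change (c * (pow_n (K := C_Ring) (z : C) n * coeff f n)
        = pow_n (K := C_Ring) (z : C) n * (c * coeff f n))%C.
ring.
Qed.

Lemma coeff_kernel (w : disk) (n : nat) :
  coeff (kernel w) n = (Cconj w ^ n)%C.
Proof.
assert (Hw : Cmod (Cconj w) < 1) by (rewrite Cmod_conj; apply (proj2_sig w)).
transitivity (affine_quotient_coeff (RtoC 1) (RtoC 0) (Cconj w) n).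
- revert n; apply (taylor_unique (kernel w)); [apply coeff_taylor|].
  intros z; generalize (taylor_affine_quotient (RtoC 1) (RtoC 0) _ Hw z).
  now replace (RtoC 1 + RtoC 0 * z)%C with (RtoC 1) by ring.
- destruct n as [|n]; simpl; ring.
Qed.

Lemma inner_kernel (f : H2) (w : disk) : inner f (kernel w) = f w.
Proof.
apply CSeries_unique; generalize (coeff_taylor f w).
apply is_series_ext; intros n.
change (pow_n (K := C_Ring) (w : C) n * coeff f n
        = coeff f n * Cconj (coeff (kernel w) n))%C.
rewrite coeff_kernel, Cpow_conj, Cconj_conj, (pow_n_C w); ring.
Qed.

Lemma inner_scal_r (f g : H2) (r : R) :
  inner f (H2_scal (RtoC r) g) = (RtoC r * inner f g)%C.
Proof.
unfold inner; rewrite <- CSeries_scal; apply CSeries_ext; intros n.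
rewrite coeff_scal, Cmult_conj.
rewrite Cconj_RtoC; ring.
Qed.

Lemma one_minus_Cmod2_pos (w : disk) : 0 < 1 - Cmod w ^ 2.
Proof.
destruct w as [w Hw]; simpl disk_val; pose proof (Cmod_ge_0 w); nra.
Qed.

Lemma H2_norm_kernel (w : disk) :
  / H2_norm (kernel w) * / H2_norm (kernel w) = 1 - Cmod w ^ 2.
Proof.
pose proof (one_minus_Cmod2_pos w) as Hw.
assert (Hk : Re (inner (kernel w) (kernel w)) = / (1 - Cmod w ^ 2)).
{ rewrite inner_kernel; simpl H2_fun.
  rewrite (Cmult_comm (Cconj w)), <- Cmod2_conj, <- RtoC_minus, <- RtoC_div
    by lra.
  simpl; field; lra. }
unfold H2_norm; rewrite Hk, <- Rinv_mult, sqrt_sqrt, Rinv_inv; [reflexivity|].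
left; now apply Rinv_0_lt_compat.
Qed.

(** * The Berezin transform of a Moebius composition operator *)

(** The pole of the composite is governed by [(w + alpha) / (1 + conj alpha w)],
    the image of [w] under the inverse Moebius map [moebius (- alpha)], hence a
    point of the disk. *)
Lemma in_H2_kernel_moebius (alpha w : disk) :
  in_H2 (fun z => kernel w (moebius alpha z)).
Proof.
assert (Hna : Cmod (- alpha) < 1) by (rewrite Cmod_opp; apply (proj2_sig alpha)).
set (beta := moebius (exist _ (- alpha)%C Hna) w).
assert (HD : (1 + alpha * Cconj w)%C <> RtoC 0).
{ replace (1 + alpha * Cconj w)%C with (1 - (Cconj w * - alpha))%C by ring.
  apply one_minus_neq0.
  exact (Cmod_conj_mult_lt1 w (exist _ (- alpha)%C Hna)). }
assert (HD' : (1 + Cconj alpha * w)%C <> RtoC 0).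
{ replace (1 + Cconj alpha * w)%C with (Cconj (1 + alpha * Cconj w))%C.
  - intros H; apply HD; rewrite <- (Cconj_conj (1 + _)), H.
    apply Cconj_RtoC.
  - now rewrite Cplus_conj, Cmult_conj, Cconj_conj, Cconj_RtoC. }
assert (Hbeta : Cconj beta
                = ((Cconj w + Cconj alpha) / (1 + alpha * Cconj w))%C).
{ simpl disk_val.
  rewrite Copp_conj.
  replace (1 - - Cconj alpha * w)%C with (1 + Cconj alpha * w)%C by ring.
  rewrite Cdiv_conj by exact HD'.
  rewrite Cplus_conj, Cmult_conj, Cconj_conj, Cminus_conj, Copp_conj.
  rewrite Cconj_RtoC; f_equal; ring. }
assert (Hb : Cmod (Cconj beta) < 1) by (rewrite Cmod_conj; apply (proj2_sig beta)).
clearbody beta.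
set (A := (/ (1 + alpha * Cconj w))%C).
apply in_H2_ext with
  (fun z => ((A + - (A * Cconj alpha) * z) / (1 - Cconj beta * z))%C).
2: now apply in_H2_affine_quotient.
intros z; simpl H2_fun; simpl disk_val.
pose proof (one_minus_neq0 _ (Cmod_conj_mult_lt1 alpha z)) as Hz.
pose proof (one_minus_neq0 _ (Cmod_conj_mult_lt1 w (moebius alpha z))) as Hwz.
simpl disk_val in Hwz.
pose proof (one_minus_neq0 _ (Cmod_mult_lt1 _ z Hb)) as Hbz.
rewrite Hbeta in Hbz |- *; unfold A.
assert (Hnum : (1 + alpha * Cconj w - (Cconj w + Cconj alpha) * z)%C <> RtoC 0).
{ intros H; apply Hbz.
  transitivity ((1 + alpha * Cconj w - (Cconj w + Cconj alpha) * z)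
                / (1 + alpha * Cconj w))%C; [field; exact HD|].
  rewrite H; field; exact HD. }
field; repeat split; try assumption.
replace (1 - Cconj alpha * z - Cconj w * (z - alpha))%C
  with (1 + alpha * Cconj w - (Cconj w + Cconj alpha) * z)%C by ring.
exact Hnum.
Qed.

Lemma comp_op_in_H2 (phi : disk -> disk) (f : H2) (z : disk) :
  in_H2 (fun z => f (phi z)) -> comp_op phi f z = f (phi z).
Proof.
intros H; unfold comp_op.
now destruct (excluded_middle_informative _) as [Hf|Hf].
Qed.

Lemma inner_comp_normalized_kernel (alpha z : disk) :
  inner (comp_op (moebius alpha) (normalized_kernel z)) (normalized_kernel z)
  = (RtoC (1 - Cmod z ^ 2) * kernel z (moebius alpha z))%C.
Proof.
unfold normalized_kernel at 2.
rewrite inner_scal_r, inner_kernel, comp_op_in_H2.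
- rewrite <- H2_norm_kernel, RtoC_mult.
  unfold normalized_kernel, H2_scal; cbn [H2_fun]; ring.
- exact (in_H2_scal _ (mkH2 _ (in_H2_kernel_moebius alpha z))).
Qed.

(** The numerator of [1 - conj z * moebius alpha z] is
    [1 - |z|^2 + (alpha * conj z - conj alpha * z)], whose bracket is purely
    imaginary; hence the grouping of the denominator. *)
Lemma berezin_moebius (alpha z : disk) :
  inner (comp_op (moebius alpha) (normalized_kernel z)) (normalized_kernel z)
  = (RtoC (1 - Cmod z ^ 2) * (1 - Cconj alpha * z)
     / (RtoC (1 - Cmod z ^ 2) + alpha * Cconj z - Cconj alpha * z))%C.
Proof.
rewrite inner_comp_normalized_kernel; simpl H2_fun.
pose proof (one_minus_neq0 _ (Cmod_conj_mult_lt1 alpha z)) as Hz.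
pose proof (one_minus_neq0 _ (Cmod_conj_mult_lt1 z (moebius alpha z))) as Hwz.
simpl disk_val in *.
rewrite RtoC_minus, Cmod2_conj.
assert (Hnum : (1 - z * Cconj z + alpha * Cconj z - Cconj alpha * z)%C <> RtoC 0).
{ intros H; apply Hwz.
  transitivity ((1 - z * Cconj z + alpha * Cconj z - Cconj alpha * z)
                / (1 - Cconj alpha * z))%C; [field; exact Hz|].
  rewrite H; field; exact Hz. }
field; repeat split; assumption.
Qed.

(** * Real values of the Berezin transform *)

Lemma affine_over_conj_difference (s p q : R) : s <> 0 ->
  (RtoC s * (1 - (p, q)) / (RtoC s + Cconj (p, q) - (p, q)))%C
  = (s * (s * (1 - p) + 2 * q ^ 2) / (s ^ 2 + 4 * q ^ 2),
     s * (q * (2 * (1 - p) - s)) / (s ^ 2 + 4 * q ^ 2)).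
Proof.
intros Hs.
assert (Hd : s ^ 2 + 4 * q ^ 2 <> 0).
{ assert (0 < s ^ 2) by (apply pow2_gt_0; exact Hs).
  pose proof (pow2_ge_0 q); lra. }
apply injective_projections; simpl; field; simpl in Hd; nra.
Qed.

Lemma berezin_moebius_coords (alpha z : disk) (s p q : R) :
  s = 1 - Cmod z ^ 2 -> (Cconj alpha * z)%C = (p, q) ->
  inner (comp_op (moebius alpha) (normalized_kernel z)) (normalized_kernel z)
  = (s * (s * (1 - p) + 2 * q ^ 2) / (s ^ 2 + 4 * q ^ 2),
     s * (q * (2 * (1 - p) - s)) / (s ^ 2 + 4 * q ^ 2)).
Proof.
intros Hs Hpq.
assert (Hconj : (alpha * Cconj z)%C = Cconj (p, q)).
{ rewrite <- Hpq, Cmult_conj, Cconj_conj; reflexivity. }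
rewrite berezin_moebius, Hconj, Hpq, <- Hs.
apply affine_over_conj_difference.
pose proof (one_minus_Cmod2_pos z); lra.
Qed.

(** With [p = Re (conj alpha * z)] the imaginary part is a positive multiple of
    [Im (conj alpha * z)] because [2 (1 - p) - s = 1 - 2 p + |z|^2] is at least
    [(1 - |z|)^2]. *)
Lemma berezin_moebius_real (alpha z : disk) (r : R) :
  inner (comp_op (moebius alpha) (normalized_kernel z)) (normalized_kernel z)
  = RtoC r -> 1 - Cmod alpha <= r.
Proof.
destruct (Cconj alpha * z)%C as [p q] eqn:Hpq.
rewrite (berezin_moebius_coords alpha z _ p q eq_refl Hpq).
pose proof (one_minus_Cmod2_pos z) as Hs.
assert (Hp : Rabs p <= Cmod alpha * Cmod z).
{ rewrite <- (Cmod_conj alpha), <- Cmod_mult, Hpq.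
  exact (re_le_Cmod (p, q)). }
assert (Ha1 : Cmod alpha < 1) by apply (proj2_sig alpha).
assert (Hz1 : Cmod z < 1) by apply (proj2_sig z).
pose proof (Cmod_ge_0 alpha) as Ha0; pose proof (Cmod_ge_0 z) as Hz0.
apply Rabs_le_between in Hp; destruct Hp as [Hp1 Hp2].
set (b := Cmod z) in *; set (a := Cmod alpha) in *; set (s := 1 - b ^ 2) in *.
assert (Hg : 0 < 2 * (1 - p) - s).
{ assert (p <= b) by nra; assert (0 < (1 - b) ^ 2) by (apply pow_lt; lra).
  unfold s; nra. }
assert (Hd : 0 < s ^ 2 + 4 * q ^ 2) by (pose proof (pow2_ge_0 q); nra).
intros Hr; apply (f_equal fst) in Hr as Hre; apply (f_equal snd) in Hr as Him.
cbn [fst snd RtoC] in Hre, Him.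
assert (Hq : q = 0).
{ apply (f_equal (fun x => x * (s ^ 2 + 4 * q ^ 2))) in Him.
  unfold Rdiv in Him; rewrite Rmult_assoc, Rinv_l, Rmult_1_r, Rmult_0_l in Him
    by lra.
  apply Rmult_integral in Him; destruct Him as [Him|Him]; [lra|].
  apply Rmult_integral in Him; destruct Him; lra. }
rewrite <- Hre, Hq.
replace (s * (s * (1 - p) + 2 * 0 ^ 2) / (s ^ 2 + 4 * 0 ^ 2)) with (1 - p)
  by (field; lra).
assert (a * b <= a * 1) by (apply Rmult_le_compat_l; lra); lra.
Qed.

(** The points are [i alpha t] and [- i alpha t]: there [conj alpha * z] is purely
    imaginary, equal to [i t |alpha|^2] up to sign, and the sign of its
    imaginary part affects only the imaginary part of the transform. *)
Lemma berezin_moebius_conj (alpha : disk) (t s : R) :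
  s = 1 - t ^ 2 * Cmod alpha ^ 2 -> 0 < s ->
  let r := s * (s + 2 * (t * Cmod alpha ^ 2) ^ 2)
           / (s ^ 2 + 4 * (t * Cmod alpha ^ 2) ^ 2) in
  exists y, berezin_range (comp_op (moebius alpha)) (r, y) /\
            berezin_range (comp_op (moebius alpha)) (r, - y).
Proof.
intros Hs Hs0 r.
set (Q := t * Cmod alpha ^ 2).
assert (Hval : forall e, e ^ 2 = 1 -> berezin_range (comp_op (moebius alpha))
  (r, s * (e * Q * (2 - s)) / (s ^ 2 + 4 * Q ^ 2))).
{ intros e He.
  pose (d := (0, e * t) : C).
  assert (Hmod : Cmod (d * alpha) ^ 2 = t ^ 2 * Cmod alpha ^ 2).
  { rewrite Cmod_mult, Rpow_mult_distr, (Cmod2_alt d).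
    change (Re d) with 0; change (Im d) with (e * t).
    replace (0 ^ 2 + (e * t) ^ 2) with (e ^ 2 * t ^ 2) by ring; rewrite He; ring. }
  assert (Hin : Cmod (d * alpha) < 1).
  { pose proof (Cmod_ge_0 (d * alpha)); nra. }
  exists (exist _ (d * alpha)%C Hin).
  rewrite (berezin_moebius_coords _ _ s 0 (e * Q)).
  - unfold r; fold Q.
    replace ((e * Q) ^ 2) with (e ^ 2 * Q ^ 2) by ring; rewrite He.
    rewrite Rminus_0_r, !Rmult_1_r, Rmult_1_l; reflexivity.
  - simpl disk_val; rewrite Hmod; exact Hs.
  - simpl disk_val; unfold Q.
    transitivity (d * (alpha * Cconj alpha))%C; [ring|].
    rewrite <- Cmod2_conj.
    apply injective_projections; simpl; ring. }
exists (s * (1 * Q * (2 - s)) / (s ^ 2 + 4 * Q ^ 2)); split.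
- apply Hval; ring.
- replace (- (s * (1 * Q * (2 - s)) / (s ^ 2 + 4 * Q ^ 2)))
    with (s * (-1 * Q * (2 - s)) / (s ^ 2 + 4 * Q ^ 2))
    by (unfold Rdiv; ring).
  apply Hval; ring.
Qed.

(** For fixed [a] the left-hand side tends to 0 with [s], so every small enough
    [s] would do.  This one makes [(1 - a) * 4 a^2 (1 - s)] equal to
    [8 s (1 - s)]; cancelling [s], it remains to see that
    [s + 2 a^2 (1 - s) < (1 - a) s + 8 (1 - s)], where [s < 1 / 2] leaves ample
    room. *)
Lemma midpoint_small (a : R) : 0 < a < 1 ->
  let s := a ^ 2 * (1 - a) / 2 in
  s * (s + 2 * (a ^ 2 * (1 - s))) / (s ^ 2 + 4 * (a ^ 2 * (1 - s))) < 1 - a.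
Proof.
intros Ha s.
assert (Ha2 : 0 < a ^ 2 < 1) by nra.
assert (Hs : 0 < s < 1 / 2) by (unfold s; nra).
assert (Hd : 0 < s ^ 2 + 4 * (a ^ 2 * (1 - s))) by nra.
apply Rmult_lt_reg_r with (s ^ 2 + 4 * (a ^ 2 * (1 - s))); [exact Hd|].
unfold Rdiv; rewrite Rmult_assoc, Rinv_l, Rmult_1_r by lra.
replace ((1 - a) * (s ^ 2 + 4 * (a ^ 2 * (1 - s))))
  with (s * ((1 - a) * s + 8 * (1 - s))) by (unfold s; field).
apply Rmult_lt_compat_l; nra.
Qed.

Theorem theorem4p5 (alpha : disk) :
  Cconvex (berezin_range (comp_op (moebius alpha))) <-> (alpha : C) = RtoC 0.
Proof.
split.
- intros Hconv.
  destruct (excluded_middle_informative ((alpha : C) = RtoC 0)) as [|Hne];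
    [assumption|exfalso].
  assert (Ha : 0 < Cmod alpha < 1).
  { split; [now apply Cmod_gt_0 | apply (proj2_sig alpha)]. }
  set (a := Cmod alpha) in *.
  set (s := a ^ 2 * (1 - a) / 2).
  assert (Ha2 : 0 < a ^ 2 < 1) by nra.
  assert (Hs : 0 < s < 1) by (unfold s; nra).
  (* The points [i alpha t] and [- i alpha t] have squared modulus [1 - s]. *)
  set (t := sqrt (1 - s) / a).
  assert (Ht : t ^ 2 * a ^ 2 = 1 - s).
  { unfold t, Rdiv; rewrite Rpow_mult_distr, pow2_sqrt by lra.
    field; lra. }
  destruct (berezin_moebius_conj alpha t s) as [y [Hy Hy']];
    [fold a; lra | lra |].
  fold a in Hy, Hy'.
  replace ((t * a ^ 2) ^ 2) with (a ^ 2 * (1 - s)) in Hy, Hy'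
    by (rewrite <- Ht; ring).
  pose proof (midpoint_small a Ha) as Hr; cbv zeta in Hr; fold s in Hr.
  set (r := s * (s + _) / _) in *.
  destruct (Hconv _ _ (1 / 2) Hy Hy') as [w Hw]; [lra|].
  assert (Hmid : (RtoC (1 / 2) * (r, y) + RtoC (1 - 1 / 2) * (r, (- y)%R))%C
                 = RtoC r).
  { apply injective_projections; simpl; field. }
  rewrite Hmid in Hw; symmetry in Hw.
  apply berezin_moebius_real in Hw; fold a in Hw; lra.
- intros H0.
  assert (Hone : forall z,
    inner (comp_op (moebius alpha) (normalized_kernel z)) (normalized_kernel z)
    = RtoC 1).
  { intros z; rewrite (berezin_moebius_coords _ _ _ 0 0 eq_refl).
    - pose proof (one_minus_Cmod2_pos z) as Hz.
      apply injective_projections; simpl in *; field; lra.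
    - rewrite H0; apply injective_projections; simpl; ring. }
  intros u v t [z Hu] [z' Hv] _; exists z.
  rewrite Hone in *; rewrite Hu, Hv.
  apply injective_projections; simpl; ring.
Qed.
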